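(* Let $R,C\ge1$ and $N\ge2$ be integers, let $1=r_1<r_2<\cdots<r_{N+1}=R+1$ and $1=c_1<c_2<\cdots<c_{N+1}=C+1$ be integers, and let $S_n=\{(i,j)\mid r_n\le i<r_{n+1},\ c_n\le j<c_{n+1}\}$ for $n=1,\ldots,N$. If $N=2$, the set of moves of Type I in $\mathcal{M}_{S_1,\ldots,S_N}$ forms the unique minimal Markov basis for the configuration $A_{S_1,\ldots,S_N}$. If $N\ge3$, the set of moves of Types I and II in $\mathcal{M}_{S_1,\ldots,S_N}$ forms the unique minimal Markov basis for the configuration $A_{S_1,\ldots,S_N}$.
   Context: Let $\mathbb{N}=\{0,1,2,\ldots\}$ and $\mathcal{I}=\{(i,j)\mid 1\le i\le R,\ 1\le j\le C\}$. The configuration $A=A_{S_1,\ldots,S_N}$ is the zero-one matrix with $A\mathbf{x}=(x_{1+},\ldots,x_{R+},x_{+1},\ldots,x_{+C},x_{S_1},\ldots,x_{S_N})'$ for $\mathbf{x}=(x_{ij})_{(i,j)\in\mathcal{I}}$, where $x_{i+}=\sum_jx_{ij}$, $x_{+j}=\sum_ix_{ij}$, $x_{S_n}=\sum_{(i,j)\in S_n}x_{ij}$. The set of moves is $\mathcal{M}_{S_1,\ldots,S_N}=\{\mathbf{z}\in\mathbb{Z}^{\mathcal{I}}\mid A\mathbf{z}=0\}$, and the fibers are $\mathcal{F}_{\mathbf{t}}=\{\mathbf{x}\in\mathbb{N}^{\mathcal{I}}\mid A\mathbf{x}=\mathbf{t}\}$. A finite set $\mathcal{B}$ of moves that is sign-invariant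 ($\mathbf{z}\in\mathcal{B}\Rightarrow-\mathbf{z}\in\mathcal{B}$) is a Markov basis for $A$ if for every $\mathbf{t}$ and all $\mathbf{x}\ne\mathbf{y}$ in $\mathcal{F}_{\mathbf{t}}$ there exist $U>0$ and $\mathbf{z}_1,\ldots,\mathbf{z}_U\in\mathcal{B}$ (repetitions allowed) with $\mathbf{y}=\mathbf{x}+\sum_{s=1}^{U}\mathbf{z}_s$ and $\mathbf{x}+\sum_{s=1}^{u}\mathbf{z}_s\in\mathcal{F}_{\mathbf{t}}$ for $1\le u\le U$. Only sign-invariant sets are considered as Markov bases. A Markov basis is minimal if no proper sign-invariant subset of it is a Markov basis. Blocks: $\mathcal{I}_{kl}=\{(i,j)\mid r_k\le i<r_{k+1},\ c_l\le j<c_{l+1}\}$ for $1\le k,l\le N$. Put $S=S_1\cup\cdots\cup S_N=\mathcal{I}_{11}\cup\cdots\cup\mathcal{I}_{NN}$ and $S^C=\mathcal{I}\setminus S$. Let $E_{ij}$ denote the table with entry $1$ at $(i,j)$ and $0$ elsewhere. Type I: $E_{i_1j_1}+E_{i_2j_2}-E_{i_1j_2}-E_{i_2j_1}$ with $i_1\ne i_2$, $j_1\ne j_2$. Type II: $E_{i_1j_2}+E_{i_2j_3}+E_{i_3j_1}-E_{i_1j_3}-E_{i_2j_1}-E_{i_3j_2}$ with $i_1,i_2,i_3$ distinct and $j_1,j_2,j_3$ distinct, where the six nonzero cells belong to distinct blocks in $S^C$.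
   Formalization: Type II moves are additionally required to have their three zero cells (i1,j1), (i2,j2), (i3,j3) in S; this is automatic for N=3, while for N≥4 the claim without it is false, since the extra moves split into two Type I moves and the set is not minimal. *)

(* Defs.v *)
From mathcomp Require Import all_boot all_order all_algebra.
From mathcomp Require Import classical_sets cardinality.

Set Implicit Arguments.
Unset Strict Implicit.
Unset Printing Implicit Defensive.

Import Order.TTheory GRing.Theory Num.Theory.

Local Open Scope ring_scope.

(* A configuration on R x C tables is an integer matrix whose columns are
   indexed by the cells, listed in the order of mxvec. *)
Definition stats (R C m : nat) (A : 'M[int]_(m, R * C)) (x : 'M[int]_(R, C)) :
    'cV[int]_m :=
  A *m (mxvec x)^T.

Definition config (R C N : nat) (S : 'I_N -> {set 'I_R * 'I_C}) :
    'M[int]_(R + C + N, R * C) :=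
  col_mx
    (col_mx (\matrix_(i < R) mxvec (\matrix_(k < R, l < C) (k == i)%:R))
            (\matrix_(j < C) mxvec (\matrix_(k < R, l < C) (l == j)%:R)))
    (\matrix_(n < N) mxvec (\matrix_(k < R, l < C) ((k, l) \in S n)%:R)).

Lemma stats_configE (R C N : nat) (S : 'I_N -> {set 'I_R * 'I_C})
    (x : 'M[int]_(R, C)) :
  stats (config S) x =
  col_mx (col_mx (\col_i \sum_j x i j) (\col_j \sum_i x i j))
         (\col_n \sum_(p in S n) x p.1 p.2).
Proof.
have E (f : 'M[int]_(R, C)) :
    \sum_k mxvec f 0 k * mxvec x 0 k = \sum_p f p.1 p.2 * x p.1 p.2.
  rewrite (reindex _ (curry_mxvec_bij R C)) /=.
  by apply: eq_bigr => -[i j] _ /=; rewrite !mxvecE.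
rewrite /stats /config !mul_col_mx; congr col_mx; first congr col_mx.
- apply/colP=> i; rewrite !mxE.
  under eq_bigr do rewrite mxE [_^T _ _]mxE.
  rewrite E -(pair_bigA _ (fun k l => (\matrix_(k, l) (k == i)%:R) k l * x k l)).
  rewrite (bigD1 i) //= [X in _ + X]big1 ?addr0 => [|k /negPf ki].
    by apply: eq_bigr => j _; rewrite mxE eqxx mul1r.
  by rewrite big1 // => j _; rewrite mxE ki mul0r.
- apply/colP=> j; rewrite !mxE.
  under eq_bigr do rewrite mxE [_^T _ _]mxE.
  rewrite E -(pair_bigA _ (fun k l => (\matrix_(k, l) (l == j)%:R) k l * x k l)).
  apply: eq_bigr => i _ /=.
  rewrite (bigD1 j) //= [X in _ + X]big1 ?addr0 => [|k /negPf kj].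
    by rewrite mxE eqxx mul1r.
  by rewrite mxE kj mul0r.
- apply/colP=> n; rewrite !mxE.
  under eq_bigr do rewrite mxE [_^T _ _]mxE.
  rewrite E [RHS]big_mkcond /=; apply: eq_bigr => -[i j] _.
  by rewrite mxE /=; case: ifP; rewrite ?mul1r ?mul0r.
Qed.

Section MarkovBasis.

Local Open Scope classical_set_scope.

Variables (R C m : nat) (A : 'M[int]_(m, R * C)).
Implicit Types (x y z : 'M[int]_(R, C)) (B : set 'M[int]_(R, C)).

Definition moves : set 'M[int]_(R, C) := fun z => stats A z = 0.

Definition fiber (t : 'cV[int]_m) : set 'M[int]_(R, C) :=
  fun x => (forall i j, 0 <= x i j) /\ stats A x = t.

Definition sign_invariant B : Prop := forall z, B z -> B (- z).

Definition connected_in_fiber B (t : 'cV[int]_m) x y : Prop :=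
  exists zs : seq 'M[int]_(R, C),
    [/\ (0 < size zs)%N,
        forall z, z \in zs -> B z,
        y = x + \sum_(z <- zs) z
      & forall u : nat, (1 <= u <= size zs)%N ->
          fiber t (x + \sum_(z <- take u zs) z)].

Definition markov_basis B : Prop :=
  [/\ finite_set B, B `<=` moves, sign_invariant B
    & forall (t : 'cV[int]_m) x y,
        fiber t x -> fiber t y -> x <> y -> connected_in_fiber B t x y].

Definition minimal_markov_basis B : Prop :=
  markov_basis B /\
  forall B', B' `<` B -> sign_invariant B' -> ~ markov_basis B'.

Definition unique_minimal_markov_basis B : Prop :=
  minimal_markov_basis B /\
  forall B', minimal_markov_basis B' -> B' = B.

End MarkovBasis.

Section Blocks.

Variables (R C N : nat) (r c : nat -> nat).

(* Everything is numbered from 0: for k < N, the k-th row block is the interval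
   [r k, r k.+1), with r 0 = 0 and r N = R, and likewise for columns. *)
Definition block (k l : 'I_N) : {set 'I_R * 'I_C} :=
  [set p : 'I_R * 'I_C |
    (r k <= p.1 < r k.+1)%N && (c l <= p.2 < c l.+1)%N].

Definition diag_block (n : 'I_N) : {set 'I_R * 'I_C} := block n n.

Definition diag_blocks : {set 'I_R * 'I_C} :=
  (\bigcup_(n : 'I_N) diag_block n)%SET.

Definition same_block : rel ('I_R * 'I_C) :=
  fun p q => [exists k, exists l, (p \in block k l) && (q \in block k l)].

Definition typeI : set 'M[int]_(R, C) := fun z =>
  exists (i1 i2 : 'I_R) (j1 j2 : 'I_C),
    [/\ i1 != i2, j1 != j2
      & z = delta_mx i1 j1 + delta_mx i2 j2 - delta_mx i1 j2 - delta_mx i2 j1].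

(* The zero cells (i_a, j_a) of the 3 x 3 subtable are required to lie in the
   diagonal blocks. For N = 3 this follows from the conditions on the six
   nonzero cells. For N >= 4 it does not, and a z violating it is redundant: if
   (i3, j3) lies outside the diagonal blocks, then z is the sum of the two
   moves of Type I
     E_{i2 j3} + E_{i3 j1} - E_{i2 j1} - E_{i3 j3},
     E_{i1 j2} + E_{i3 j3} - E_{i1 j3} - E_{i3 j2},
   which, taken in a suitable order, can replace z in any path. *)
Definition typeII : set 'M[int]_(R, C) := fun z =>
  exists (i1 i2 i3 : 'I_R) (j1 j2 j3 : 'I_C),
    [/\ uniq [:: i1; i2; i3], uniq [:: j1; j2; j3],
        let s := [:: (i1, j2); (i2, j3); (i3, j1);
                     (i1, j3); (i2, j1); (i3, j2)] in
        all (mem (~: diag_blocks)%SET) s /\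
        pairwise (fun p q => ~~ same_block p q) s,
        all (mem diag_blocks) [:: (i1, j1); (i2, j2); (i3, j3)]
      & z = delta_mx i1 j2 + delta_mx i2 j3 + delta_mx i3 j1
            - delta_mx i1 j3 - delta_mx i2 j1 - delta_mx i3 j2].

End Blocks.

(* Main.v *)
(* Let x and y be distinct tables in the same fiber, and B the proposed basis.
   A step of B applied to x or to y keeps the fiber, so it is enough to find
   steps after which the l1-distance between x and y has decreased.  Write + and
   - for the cells where x - y is positive or negative.  An L-shaped pattern
   + - + (or - + -) whose completion to a rectangle is a move gives such a step.
   If no step exists, then cells of the same block never carry opposite signs,
   so x and y agree on the diagonal blocks (where the difference sums to zero),
   and an L-shaped pattern can only be blocked by its fourth cell lying in a
   diagonal block.  Starting from a nonzero cell and following such patterns, one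
   is led to a hexagon of Type II, which decreases the distance by at least 4.

   For uniqueness, every z in B is the difference of two 0-1 tables forming a
   whole fiber; a path joining them must use z, so z is in every Markov basis. *)
Require Import Defs.
From mathcomp Require Import all_boot all_order all_algebra.
From mathcomp Require Import classical_sets cardinality.
From mathcomp Require Import boolp zify.

Set Implicit Arguments.
Unset Strict Implicit.
Unset Printing Implicit Defensive.

Import Order.TTheory GRing.Theory Num.Theory.

Local Open Scope ring_scope.
Local Open Scope classical_set_scope.

(** * Tables, the l1-norm and exchanges of cells *)

Lemma exists_lt_of_sum_eq (I : finType) (P : pred I) (f g : I -> int) k :
  \sum_(i | P i) f i = \sum_(i | P i) g i -> P k -> g k < f k ->
  exists2 l, P l & f l < g l.
Proof.
move=> fg Pk gfk; apply/exists_inP; apply: contraTT isT => /exists_inPn le_gf.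
have : \sum_(i | P i) g i < \sum_(i | P i) f i; last by rewrite fg ltxx.
rewrite (bigD1 k) //= [ltRHS](bigD1 k) //= ltr_leD //.
by apply: ler_sum => i /andP[Pi _]; rewrite leNgt le_gf.
Qed.

Section Tables.

Variables R C : nat.
Implicit Types (x y z w : 'M[int]_(R, C)) (s P Q F : seq ('I_R * 'I_C)).

Definition nonneg x := forall i j, 0 <= x i j.

(** A list of cells stands for a table, counted with multiplicity; every move below is a difference
    of two such tables, one for each sign. *)
Definition cells s : 'M[int]_(R, C) := \sum_(p <- s) delta_mx p.1 p.2.

Lemma cellsE s i j : cells s i j = (count_mem (i, j) s)%:R.
Proof.
rewrite /cells summxE; elim: s => [|[k l] s IHs]; first by rewrite big_nil.
by rewrite big_cons IHs mxE /= natrD [_ == (i, j)]xpair_eqE !(eq_sym i) !(eq_sym j).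
Qed.

Lemma nonneg_cells s : nonneg (cells s).
Proof. by move=> i j; rewrite cellsE. Qed.

Lemma nonnegD x y : nonneg x -> nonneg y -> nonneg (x + y).
Proof. by move=> x0 y0 i j; rewrite mxE addr_ge0. Qed.

Lemma nonnegB_cells x s :
  nonneg x -> uniq s -> (forall p, p \in s -> 0 < x p.1 p.2) ->
  nonneg (x - cells s).
Proof.
move=> x0 Us xs i j; rewrite !mxE cellsE count_uniq_mem //.
have := x0 i j; have := xs (i, j); case: (_ \in _) => /=; last by lia.
by move=> /(_ isT); lia.
Qed.

Definition l1 w : nat := (\sum_p `|w p.1 p.2|)%N.

Lemma l1N w : l1 (- w) = l1 w.
Proof. by apply: eq_bigr => p _; rewrite mxE abszN. Qed.

Lemma leq_l1D w z : (l1 (w + z) <= l1 w + l1 z)%N.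
Proof.
by rewrite /l1 -big_split; apply: leq_sum => p _; rewrite mxE /=; lia.
Qed.

Lemma l1_cells s : l1 (cells s) = size s.
Proof.
rewrite /l1; under eq_bigr do rewrite cellsE natz /= -surjective_pairing.
elim: s => [|p s IHs] /=; first by rewrite big1.
rewrite big_split /= IHs (bigD1 p) //= eqxx big1 // => q /negPf.
by rewrite eq_sym => ->.
Qed.

Lemma l1B_cells w s :
  uniq s -> (forall p, p \in s -> 0 < w p.1 p.2) ->
  (l1 (w - cells s) + size s)%N = l1 w.
Proof.
move=> Us ws; rewrite -[size s]l1_cells /l1 -big_split; apply: eq_bigr => -[i j] _ /=.
rewrite !mxE cellsE count_uniq_mem //.
by have := ws (i, j); case: (_ \in _) => [/(_ isT)|_] /=; lia.
Qed.

Lemma l1_exchange w P Q F :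
  uniq P -> uniq Q ->
  (forall p, p \in P -> w p.1 p.2 < 0) -> (forall p, p \in Q -> 0 < w p.1 p.2) ->
  (l1 (w + (cells (P ++ F) - cells Q)) + size P + size Q <= l1 w + size F)%N.
Proof.
move=> UP UQ wP wQ.
(* The cells of [P] and [Q] change the norm by an exact amount, since each entry there moves one
   unit towards 0; [F] is left to the triangle inequality. *)
have -> : w + (cells (P ++ F) - cells Q) = (w - cells Q + cells P) + cells F.
  by rewrite /cells big_cat -!addrA /=; congr (_ + _); rewrite [RHS]addrC addrA.
have -> : l1 w = (l1 (w - cells Q + cells P) + size P + size Q)%N.
  rewrite -(l1B_cells UQ wQ); congr (_ + _)%N.
  rewrite -[LHS]l1N -(@l1B_cells _ P) //.
    by rewrite -[l1 (_ + cells P)]l1N !opprD.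
  move=> p Pp; rewrite !mxE cellsE natz.
  by rewrite oppr_gt0 subr_lt0 (lt_le_trans (wP _ Pp)).
have := leq_l1D (w - cells Q + cells P) (cells F); rewrite l1_cells; lia.
Qed.

(* The step gains one unit at the cells of P and of Q, and may lose one at F. *)
Lemma exchange_le x y P Q F :
  nonneg x -> nonneg y -> uniq P -> uniq Q ->
  (forall p, p \in P -> x p.1 p.2 < y p.1 p.2) ->
  (forall p, p \in Q -> y p.1 p.2 < x p.1 p.2) ->
  nonneg (x + (cells (P ++ F) - cells Q)) /\
  (l1 (x + (cells (P ++ F) - cells Q) - y) + size P + size Q
     <= l1 (x - y) + size F)%N.
Proof.
move=> x0 y0 UP UQ xyP yxQ; split.
  rewrite addrCA; apply: nonnegD (@nonneg_cells _) _; apply: nonnegB_cells => //.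
  by move=> p pQ; apply: le_lt_trans (yxQ p pQ).
rewrite addrAC; apply: l1_exchange => // p pPQ; rewrite !mxE.
  by rewrite subr_lt0 xyP.
by rewrite subr_gt0 yxQ.
Qed.

End Tables.

(** * Paths of moves and indispensable moves *)

Section Reachability.

Variables (R C m : nat) (A : 'M[int]_(m, R * C)) (B : set 'M[int]_(R, C)).
Implicit Types (x y z u v : 'M[int]_(R, C)).

Lemma statsB x y : stats A (x - y) = stats A x - stats A y.
Proof. by rewrite /stats !linearB. Qed.

Lemma statsD x y : stats A (x + y) = stats A x + stats A y.
Proof. by rewrite /stats !linearD. Qed.

Lemma statsN x : stats A (- x) = - stats A x.
Proof. by rewrite /stats !linearN. Qed.

Lemma movesB x y : moves A (x - y) <-> stats A x = stats A y.
Proof.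
by rewrite /moves statsB; split=> [/eqP|->]; rewrite ?subrr // subr_eq0 => /eqP.
Qed.

(** Unlike [connected_in_fiber], this allows the empty path and checks only nonnegativity along the
    way: the statistics are constant once [B] consists of moves. *)
Inductive reach : 'M[int]_(R, C) -> 'M[int]_(R, C) -> Prop :=
| reach_refl x : reach x x
| reach_step x y z : B z -> nonneg (x + z) -> reach (x + z) y -> reach x y.

Lemma reach1 x z : B z -> nonneg (x + z) -> reach x (x + z).
Proof. by move=> Bz xz; apply: (reach_step Bz xz); apply: reach_refl. Qed.

Lemma reach_trans x y z : reach x y -> reach y z -> reach x z.
Proof.
by elim=> {x y} // x y v Bv xv _ IH yz; apply: (reach_step Bv xv); apply: IH.
Qed.

Lemma reach_nonneg x y : nonneg x -> reach x y -> nonneg y.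
Proof. by move=> + xy; elim: xy => {x y} // x y z Bz xz _ IH _; apply: IH. Qed.

Lemma reach_stats x y : B `<=` moves A -> reach x y -> stats A y = stats A x.
Proof.
by move=> BA; elim=> {x y} // x y z /BA Az _ _ ->; rewrite statsD Az addr0.
Qed.

Lemma reach_sym x y : sign_invariant B -> nonneg x -> reach x y -> reach y x.
Proof.
move=> BN + xy; elim: xy => {x y} [x|x y z Bz xz _ IH] x0; first exact: reach_refl.
apply: (reach_trans (IH xz)); rewrite -{2}(addrK z x).
by apply: reach1; [apply: BN | rewrite addrK].
Qed.

Lemma reach_seq x y : reach x y ->
  exists zs, [/\ forall z, z \in zs -> B z, y = x + \sum_(z <- zs) z
    & forall k, (0 < k <= size zs)%N -> nonneg (x + \sum_(z <- take k zs) z)].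
Proof.
elim=> {x y} [x|x y z Bz xz _ [zs [Bzs -> zs0]]].
  by exists [::]; split=> [//||[]//]; rewrite big_nil addr0.
exists (z :: zs); split=> [z'||[|[|k]] // ksz].
- by rewrite inE => /predU1P[->//|/Bzs].
- by rewrite big_cons addrA.
- by rewrite /= take0 big_seq1.
- by rewrite /= big_cons addrA; apply: zs0.
Qed.

Lemma reach_connected t x y : B `<=` moves A -> x <> y -> fiber A t x ->
  reach x y -> connected_in_fiber A B t x y.
Proof.
move=> BA xNy [x0 xt] /reach_seq[zs [Bzs yE zs0]]; exists zs; split=> //.
  by case: zs yE {Bzs zs0} => // yE; case: xNy; rewrite yE big_nil addr0.
move=> k kzs; split; first exact: zs0.
rewrite statsD xt -[RHS]addr0; congr (_ + _).
have : {subset take k zs <= zs} by move=> z; apply: mem_take.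
elim: (take k zs) => [|z s IHs] sub.
  by rewrite big_nil -(subrr x) statsB subrr.
rewrite big_cons statsD IHs ?addr0 => [|z' z's].
  by apply: BA; apply: Bzs; apply: sub; rewrite inE eqxx.
by apply: sub; rewrite inE z's orbT.
Qed.

(** Both ends may travel: paths are reversible for a sign-invariant [B], so it is enough that the
    two ends eventually meet. *)
Definition reducible x y :=
  exists x' y', [/\ reach x x', reach y y' & (l1 (x' - y') < l1 (x - y))%N].

Lemma reducible_sym x y : reducible x y -> reducible y x.
Proof.
move=> [x' [y' [xx' yy' lt]]]; exists y', x'; split=> //.
by rewrite -l1N opprB -[ltnRHS]l1N opprB.
Qed.

Lemma reducible_step x y z : B z -> nonneg (x + z) ->
  (l1 (x + z - y) < l1 (x - y))%N -> reducible x y.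
Proof.
by move=> Bz xz lt; exists (x + z), y; split=> //; [apply: reach1 | apply: reach_refl].
Qed.

(** Permits a preparatory step that gains nothing by itself but creates a better pattern of
    signs. *)
Lemma reducible_step_le x y z : B z -> nonneg (x + z) ->
  (l1 (x + z - y) <= l1 (x - y))%N -> reducible (x + z) y -> reducible x y.
Proof.
move=> Bz xz le [x' [y' [xx' yy' lt]]]; exists x', y'; split=> //.
  exact: reach_step xx'.
exact: leq_trans lt le.
Qed.

Lemma reach_of_reducible :
  B `<=` moves A -> sign_invariant B ->
  (forall x y, nonneg x -> nonneg y -> stats A x = stats A y -> x <> y ->
     reducible x y) ->
  forall x y, nonneg x -> nonneg y -> stats A x = stats A y -> reach x y.
Proof.
move=> BA BN red x y; have [n] := ubnP (l1 (x - y)).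
elim: n => // n IHn in x y *; rewrite ltnS => le_n x0 y0 Axy.
have [->|/eqP xNy] := eqVneq x y; first exact: reach_refl.
have [x' [y' [xx' yy' lt]]] := red x y x0 y0 Axy xNy.
apply: (reach_trans xx'); apply: reach_trans (reach_sym BN y0 yy').
apply: IHn; first exact: leq_trans lt le_n.
- exact: reach_nonneg xx'.
- exact: reach_nonneg yy'.
- by rewrite (reach_stats BA xx') (reach_stats BA yy').
Qed.

(** In a fiber with only the two tables [u] and [v], a path from [u] to [v] can leave [u] only by
    the step [v - u]. *)
Lemma indispensable_move u v :
  markov_basis A B -> nonneg u -> nonneg v -> stats A u = stats A v -> u <> v ->
  (forall x, nonneg x -> stats A x = stats A u -> x = u \/ x = v) -> B (v - u).
Proof.
move=> [_ _ _ Bconn] u0 v0 Auv uNv two.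
have [zs [_ Bzs vE zsF]] := Bconn _ u v (conj u0 erefl) (conj v0 (esym Auv)) uNv.
elim: zs vE Bzs zsF => [|z zs IHzs] vE Bzs zsF.
  by case: uNv; rewrite vE big_nil addr0.
have Bz : B z by apply: Bzs; rewrite inE eqxx.
have [] := zsF 1%N isT; rewrite /= take0 big_seq1 => uz0 uzA.
have [uz|<-] := two _ uz0 uzA; last by rewrite addrC addKr.
(* A Markov basis may contain the zero table, so the path may stay at [u]; such a step is
   dropped. *)
have z0 : z = 0 by apply: (addrI u); rewrite uz addr0.
apply: IHzs => [|z' z'zs|k kzs].
- by rewrite vE big_cons z0 add0r.
- by apply: Bzs; rewrite inE z'zs orbT.
- have := zsF k.+1; rewrite /= big_cons z0 add0r; apply.
  by case/andP: kzs.
Qed.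

End Reachability.

Lemma unique_minimal_of_indispensable (R C m : nat) (A : 'M[int]_(m, R * C))
  (B : set 'M[int]_(R, C)) :
  markov_basis A B -> (forall B', markov_basis A B' -> B `<=` B') ->
  unique_minimal_markov_basis A B.
Proof.
move=> mB least; split.
  by split=> // B' [_ BB'] _ /least.
move=> B' [mB' minB']; apply: contrapT => B'NB.
have BB' := least B' mB'; have [_ _ BN _] := mB.
by apply: (minB' B) => //; split=> // B'B; apply: B'NB; apply/seteqP.
Qed.

(** * Equality of statistics and the tables of a fiber *)

Section ConfigStats.

Variables R C N : nat.
Variable S : 'I_N -> {set 'I_R * 'I_C}.
Implicit Types (x y : 'M[int]_(R, C)) (s P Q : seq ('I_R * 'I_C)).

(** Rows and columns appear as predicates on cells, like the blocks, so that [sum_cells] and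
    [exists_lt_of_sum_eq] serve all three. *)
Lemma stats_config_eqP x y : stats (config S) x = stats (config S) y <->
  [/\ forall i, \sum_(p | p.1 == i) x p.1 p.2 = \sum_(p | p.1 == i) y p.1 p.2,
      forall j, \sum_(p | p.2 == j) x p.1 p.2 = \sum_(p | p.2 == j) y p.1 p.2
    & forall n, \sum_(p in S n) x p.1 p.2 = \sum_(p in S n) y p.1 p.2].
Proof.
have rowE w i : \sum_(p : 'I_R * 'I_C | p.1 == i) w p.1 p.2 = \sum_j w i j :> int.
  rewrite -(@big_pred1_eq _ _ +%R _ i (fun k => \sum_j w k j)).
  by rewrite pair_big; apply: eq_bigl => p; rewrite andbT.
have colE w j : \sum_(p : 'I_R * 'I_C | p.2 == j) w p.1 p.2 = \sum_i w i j :> int.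
  under [RHS]eq_bigr do rewrite -(@big_pred1_eq _ _ +%R _ j).
  by rewrite pair_big.
rewrite !stats_configE; split.
  move=> /eq_col_mx[/eq_col_mx[/colP rE /colP cE] /colP bE]; split=> k.
  - by have := rE k; rewrite !mxE !rowE.
  - by have := cE k; rewrite !mxE !colE.
  - by have := bE k; rewrite !mxE.
move=> [rE cE bE]; congr col_mx; first congr col_mx; apply/colP=> k.
- by have := rE k; rewrite !mxE !rowE.
- by have := cE k; rewrite !mxE !colE.
- by have := bE k; rewrite !mxE.
Qed.

Lemma sum_cells (a : pred ('I_R * 'I_C)) s :
  \sum_(p | a p) cells s p.1 p.2 = (count a s)%:R.
Proof.
under eq_bigr do rewrite cellsE -surjective_pairing.
rewrite -natr_sum; congr _%:R; elim: s => [|q s IHs] /=; first by rewrite big1.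
rewrite big_split IHs /=; congr (_ + _)%N.
rewrite big_mkcond (bigD1 q) //= eqxx big1 ?addn0 => [|p /negPf].
  by case: (a q).
by rewrite eq_sym => ->; case: (a p).
Qed.

Lemma stats_cells_eq P Q :
  perm_eq (map fst P) (map fst Q) -> perm_eq (map snd P) (map snd Q) ->
  (forall n, count (mem (S n)) P = count (mem (S n)) Q) ->
  stats (config S) (cells P) = stats (config S) (cells Q).
Proof.
move=> /permP rPQ /permP cPQ bPQ; apply/stats_config_eqP; split=> k.
- by rewrite !sum_cells; have := rPQ (pred1 k); rewrite !count_map => ->.
- by rewrite !sum_cells; have := cPQ (pred1 k); rewrite !count_map => ->.
- by rewrite !sum_cells bPQ.
Qed.

Lemma sum_support x (a : pred ('I_R * 'I_C)) s :
  uniq s -> all a s -> (forall p, a p -> p \notin s -> x p.1 p.2 = 0) ->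
  \sum_(p | a p) x p.1 p.2 = \sum_(p <- s) x p.1 p.2.
Proof.
move=> Us /allP sa x0; rewrite big_uniq // big_mkcond [RHS]big_mkcond /=.
apply: eq_bigr => p _; case: ifPn => [ap|/negP aNp]; case: ifPn => // ps.
  exact: x0.
by case: aNp; apply: sa.
Qed.

(** The shape of the fiber of a basis move: linear equations leave one integer parameter [v], whose
    values 0 and 1 give the two tables. *)
Lemma eq_cells_cat x P Q v : uniq (P ++ Q) -> 0 <= v <= 1 ->
  (forall p, p \in P -> x p.1 p.2 = v) ->
  (forall p, p \in Q -> x p.1 p.2 = 1 - v) ->
  (forall p, p \notin P ++ Q -> x p.1 p.2 = 0) ->
  x = cells Q \/ x = cells P.
Proof.
rewrite cat_uniq => /and3P[UP /hasPn PQ UQ] v01 xP xQ x0.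
have [v0|v1] : v = 0 \/ v = 1 by lia.
- left; apply/matrixP=> i j; rewrite cellsE count_uniq_mem //.
  case: (boolP (_ \in Q)) => [/xQ /= ->|jQ]; first by rewrite v0 subr0.
  case: (boolP ((i, j) \in P)) => [/xP /= ->//|jP].
  by apply: (x0 (i, j)); rewrite mem_cat negb_or jP.
- right; apply/matrixP=> i j; rewrite cellsE count_uniq_mem //.
  case: (boolP (_ \in P)) => [/xP /= ->//|jP].
  case: (boolP ((i, j) \in Q)) => [/xQ /= ->|jQ]; first by rewrite v1 subrr.
  by apply: (x0 (i, j)); rewrite mem_cat negb_or jP.
Qed.

Section Fiber.

Variables (x : 'M[int]_(R, C)) (s : seq ('I_R * 'I_C)).
Hypotheses (x0 : nonneg x) (xs : stats (config S) x = stats (config S) (cells s)).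

Lemma fiber_row i : \sum_(p | p.1 == i) x p.1 p.2 = (count (fun p => p.1 == i) s)%:R.
Proof. by have [-> _ _] := (stats_config_eqP _ _).1 xs; rewrite sum_cells. Qed.

Lemma fiber_col j : \sum_(p | p.2 == j) x p.1 p.2 = (count (fun p => p.2 == j) s)%:R.
Proof. by have [_ -> _] := (stats_config_eqP _ _).1 xs; rewrite sum_cells. Qed.

Lemma fiber_block n : \sum_(p in S n) x p.1 p.2 = (count (mem (S n)) s)%:R.
Proof. by have [_ _ ->] := (stats_config_eqP _ _).1 xs; rewrite sum_cells. Qed.

Lemma fiber_row0 i j : i \notin map fst s -> x i j = 0.
Proof.
move=> si; have := fiber_row i.
have -> : count (fun p : 'I_R * 'I_C => p.1 == i) s = 0%N.
  by rewrite -(count_map fst (pred1 i)); apply/count_memPn.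
move/psumr_eq0P => /(_ (fun p _ => x0 p.1 p.2)) x00.
by apply: (x00 (i, j)) => /=.
Qed.

Lemma fiber_col0 i j : j \notin map snd s -> x i j = 0.
Proof.
move=> sj; have := fiber_col j.
have -> : count (fun p : 'I_R * 'I_C => p.2 == j) s = 0%N.
  by rewrite -(count_map snd (pred1 j)); apply/count_memPn.
move/psumr_eq0P => /(_ (fun p _ => x0 p.1 p.2)) x00.
by apply: (x00 (i, j)) => /=.
Qed.

Lemma fiber_block0 n i j :
  ~~ has (mem (S n)) s -> (i, j) \in S n -> x i j = 0.
Proof.
rewrite has_count -eqn0Ngt => /eqP s0 ijn; have := fiber_block n.
rewrite s0 => /psumr_eq0P => /(_ (fun p _ => x0 p.1 p.2)) x00.
exact: (x00 (i, j)).
Qed.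

End Fiber.

End ConfigStats.

(** * Diagonal blocks and moves of Types I and II *)

Section BlockModel.

Variables (R C N : nat) (r c : nat -> nat).
(** [a] and [b] give the block index of a row and of a column. With [mem_block], comparing indices
    replaces all reasoning on intervals. *)
Variables (a : 'I_R -> 'I_N) (b : 'I_C -> 'I_N).
Hypothesis mem_block :
  forall k l (i : 'I_R) (j : 'I_C),
    ((i, j) \in block R C r c k l) = (a i == k) && (b j == l).

Local Notation A := (config (@diag_block R C N r c)).
Local Notation B := (moves A `&` (@typeI R C `|` @typeII R C N r c)).
Implicit Types (x y : 'M[int]_(R, C)).

Lemma mem_diag_blocks i j : ((i, j) \in diag_blocks R C N r c) = (a i == b j).
Proof.
apply/bigcupP/eqP => [[n _]|ab]; first by rewrite mem_block => /andP[/eqP-> /eqP->].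
by exists (a i) => //; rewrite mem_block ab !eqxx.
Qed.

Lemma mem_diag_block_off (n : 'I_N) i j :
  a i != b j -> ((i, j) \in diag_block R C r c n) = false.
Proof.
rewrite mem_block => abN; apply/andP => -[/eqP aE /eqP bE].
by rewrite aE bE eqxx in abN.
Qed.

Lemma same_blockE i j i' j' :
  same_block N r c (i, j) (i', j') = (a i == a i') && (b j == b j').
Proof.
apply/existsP/andP => [[k /existsP[l]]|[/eqP aE /eqP bE]].
  by rewrite !mem_block => /andP[/andP[/eqP-> /eqP->] /andP[/eqP-> /eqP->]].
by exists (a i); apply/existsP; exists (b j); rewrite !mem_block aE bE !eqxx.
Qed.

Lemma typeIE z : typeI z <-> exists (i1 i2 : 'I_R) (j1 j2 : 'I_C),
  [/\ i1 != i2, j1 != j2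
    & z = cells [:: (i1, j1); (i2, j2)] - cells [:: (i1, j2); (i2, j1)]].
Proof.
by split=> -[i1 [i2 [j1 [j2 [iN jN ->]]]]]; exists i1, i2, j1, j2; split=> //;
  rewrite /cells !big_cons !big_nil !addr0 opprD !addrA.
Qed.

(* When the three zero cells are diagonal, the row blocks and the column blocks
   of the hexagon coincide, and the conditions on the six other cells reduce to
   the three blocks being distinct. *)
Lemma typeIIE z : typeII N r c z <-> exists (i1 i2 i3 : 'I_R) (j1 j2 j3 : 'I_C),
  [/\ uniq [:: a i1; a i2; a i3], [:: a i1; a i2; a i3] = [:: b j1; b j2; b j3]
    & z = cells [:: (i1, j2); (i2, j3); (i3, j1)]
          - cells [:: (i1, j3); (i2, j1); (i3, j2)]].
Proof.
have E (i1 i2 i3 : 'I_R) (j1 j2 j3 : 'I_C) :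
    cells [:: (i1, j2); (i2, j3); (i3, j1)]
      - cells [:: (i1, j3); (i2, j1); (i3, j2)] =
    delta_mx i1 j2 + delta_mx i2 j3 + delta_mx i3 j1
      - delta_mx i1 j3 - delta_mx i2 j1 - delta_mx i3 j2.
  by rewrite /cells !big_cons !big_nil !addr0 !opprD !addrA.
split=> -[i1 [i2 [i3 [j1 [j2 [j3]]]]]].
  case=> _ _ [off _] /=; rewrite !mem_diag_blocks andbT.
  move=> /and3P[/eqP e1 /eqP e2 /eqP e3] ->.
  exists i1, i2, i3, j1, j2, j3; rewrite E; split=> //; last by rewrite e1 e2 e3.
  move: off; rewrite /= !finset.in_setC !mem_diag_blocks -e1 -e2 -e3 !inE.
  by rewrite negb_or => /and5P[-> -> _ -> _].
case=> Ua [e1 e2 e3] ->; exists i1, i2, i3, j1, j2, j3; rewrite E.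
have Ub : uniq [:: b j1; b j2; b j3] by rewrite -e1 -e2 -e3.
split=> //.
- by apply: (@map_uniq _ _ a).
- by apply: (@map_uniq _ _ b).
- rewrite /= !finset.in_setC !mem_diag_blocks !same_blockE -e1 -e2 -e3.
  move: Ua; rewrite /= !inE !negb_or => /and3P[/andP[n12 n13] n23 _].
  by rewrite !(eq_sym (a i2) (a i1)) !(eq_sym (a i3))
    (negPf n12) (negPf n13) (negPf n23) !eqxx.
- by rewrite /= !mem_diag_blocks e1 e2 e3 !eqxx.
Qed.

(** Guarantees that the rectangle has zero sum on each diagonal block: its opposite signs cancel
    within a block when two rows or two columns share one, and otherwise no corner is diagonal. *)
Definition swappable i i' j j' :=
  [|| a i == a i', b j == b j' |
      [&& a i != b j, a i != b j', a i' != b j & a i' != b j']].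

Lemma typeI_move i i' j j' : i != i' -> j != j' -> swappable i i' j j' ->
  B (cells [:: (i, j'); (i', j)] - cells [:: (i, j); (i', j')]).
Proof.
move=> iN jN sw; split; last first.
  by left; apply/typeIE; exists i, i', j', j; rewrite eq_sym in jN *.
apply/movesB/stats_cells_eq => //=; first by rewrite -(perm_rot 1).
move=> n; rewrite !mem_block !addn0.
case/or3P: sw => [/eqP->|/eqP->|/and4P[]].
- by rewrite addnC.
- by [].
move=> *; rewrite -!mem_block !mem_diag_block_off //.
Qed.

(** Each row and column of the hexagon carries one cell of each sign, and none of its six cells lies
    in a diagonal block. *)
Lemma typeII_move i1 i2 i3 j1 j2 j3 :
  uniq [:: a i1; a i2; a i3] -> [:: a i1; a i2; a i3] = [:: b j1; b j2; b j3] ->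
  B (cells [:: (i1, j2); (i2, j3); (i3, j1)]
     - cells [:: (i1, j3); (i2, j1); (i3, j2)]).
Proof.
move=> Ua abE; split; last by right; apply/typeIIE; exists i1, i2, i3, j1, j2, j3.
apply/movesB/stats_cells_eq => //=.
  by rewrite -(perm_rot 1).
case: abE => e1 e2 e3; move: Ua; rewrite /= !inE !negb_or.
case/and3P=> /andP[n12 n13] n23 _ n; rewrite !mem_diag_block_off -?e1 -?e2 -?e3 //.
all: by rewrite eq_sym.
Qed.

(** * Reducing the distance between two tables of a fiber *)

Definition paired x y := [/\ nonneg x, nonneg y & stats A x = stats A y].

Lemma paired_sym x y : paired x y -> paired y x.
Proof. by case=> x0 y0 xy. Qed.

Lemma paired_row x y i j : paired x y -> y i j < x i j -> exists j', x i j' < y i j'.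
Proof.
move=> [_ _ /stats_config_eqP[rE _ _]] lt.
have [[k l] /= /eqP-> ?] := exists_lt_of_sum_eq (rE i) (eqxx (i, j).1) lt.
by exists l.
Qed.

Lemma paired_col x y i j : paired x y -> y i j < x i j -> exists i', x i' j < y i' j.
Proof.
move=> [_ _ /stats_config_eqP[_ cE _]] lt.
have [[k l] /= /eqP-> ?] := exists_lt_of_sum_eq (cE j) (eqxx (i, j).2) lt.
by exists k.
Qed.

(** Three corners gain one unit each and the fourth, [(i', j)], loses at most one, so the distance
    drops by at least 2. *)
Lemma corner_reducible x y i i' j j' : paired x y ->
  y i j < x i j -> x i j' < y i j' -> y i' j' < x i' j' -> swappable i i' j j' ->
  reducible B x y.
Proof.
move=> [x0 y0 _] ij ij' i'j' sw.
have iN : i != i' by apply: contraTneq ij' => ->; rewrite -leNgt ltW.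
have jN : j != j' by apply: contraTneq ij => ->; rewrite -leNgt ltW.
have [] := @exchange_le _ _ x y [:: (i, j')] [:: (i, j); (i', j')] [:: (i', j)] x0 y0.
- by [].
- by rewrite /= inE xpair_eqE (negPf iN).
- by move=> p; rewrite inE => /eqP->.
- by move=> p; rewrite !inE => /orP[]/eqP->.
move=> xz0 le; apply: reducible_step (typeI_move iN jN sw) xz0 _.
by move: le; rewrite /= addnAC leq_add2r addn2 => /ltnW.
Qed.

(** The column sum provides a third corner in column [j'], and the rectangle is a move because its
    two columns share a block. *)
Lemma row_reducible x y i j j' : paired x y ->
  y i j < x i j -> x i j' < y i j' -> b j = b j' -> reducible B x y.
Proof.
move=> xy ij ij' bE; have [i' i'j'] := paired_col (paired_sym xy) ij'.
by apply: corner_reducible xy ij ij' i'j' _; rewrite /swappable bE eqxx orbT.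
Qed.

Lemma col_reducible x y i i' j : paired x y ->
  y i j < x i j -> x i' j < y i' j -> a i = a i' -> reducible B x y.
Proof.
move=> xy ij i'j aE; have [j' i'j'] := paired_row (paired_sym xy) i'j.
by apply: corner_reducible xy i'j' i'j ij _; rewrite /swappable aE eqxx.
Qed.

(* A swap inside the strip of row blocks moves the - at (i', j') to (i, j')
   without increasing the distance, which creates a pattern for row_reducible. *)
Lemma block_reducible x y i i' j j' : paired x y ->
  y i j < x i j -> x i' j' < y i' j' -> a i = a i' -> b j = b j' ->
  reducible B x y.
Proof.
move=> xy ij i'j' aE bE.
(* A nonzero difference at [(i, j')] concludes at once; the rest treats the case where [x] and [y]
   agree there. *)
have [ij'|ij'|ij'] := ltgtP (x i j') (y i j').
- exact: row_reducible xy ij ij' bE.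
- exact: col_reducible xy ij' i'j' aE.
have iN : i != i' by apply: contraTneq i'j' => <-; rewrite ij' ltxx.
have jj' : j != j' by apply: contraTneq ij => ->; rewrite ij' ltxx.
have [j'' ij''] := paired_row xy ij.
have [bE'|bN] := eqVneq (b j) (b j''); first exact: row_reducible xy ij ij'' bE'.
have jN : j'' != j' by apply: contraTneq ij'' => ->; rewrite ij' ltxx.
have [x0 y0 Axy] := xy.
have [] := @exchange_le _ _ y x [::] [:: (i, j''); (i', j')]
  [:: (i, j'); (i', j'')] y0 x0.
- by [].
- by rewrite /= inE xpair_eqE (negPf iN).
- by [].
- by move=> p; rewrite !inE => /orP[]/eqP->.
move=> /= yz0 le.
have Bz : B (cells [:: (i, j'); (i', j'')] - cells [:: (i, j''); (i', j')]).
  by apply: typeI_move; rewrite // /swappable aE eqxx.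
(* The step is applied to [y]: afterwards [x - y] is -1 at [(i, j')] and still positive at
   [(i, j)]. *)
apply: reducible_sym; apply: (reducible_step_le Bz yz0).
  by rewrite /= addn0 leq_add2r in le.
apply: reducible_sym; apply: (@row_reducible _ _ i j j') => //.
- by split=> //; rewrite statsD Axy Bz.1 addr0.
- rewrite !mxE !cellsE /= !xpair_eqE !(eq_sym _ i) !(eq_sym _ j).
  rewrite (negPf iN) (negPf jj') !andbF /=; lia.
- rewrite !mxE !cellsE /= !xpair_eqE !eqxx (negPf jN) !(eq_sym _ i) (negPf iN) /=.
  by rewrite ij'; lia.
Qed.

Section Irreducible.

Variables x y : 'M[int]_(R, C).
Hypotheses (xy : paired x y) (irr : ~ reducible B x y).

(** A positive difference in a diagonal block is compensated by a negative one in the same block,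
    which [block_reducible] excludes. *)
Lemma irreducible_diag_le i j : a i = b j -> x i j <= y i j.
Proof.
move=> ab; rewrite leNgt; apply/negP => lt.
have [_ _ /stats_config_eqP[_ _ /(_ (a i)) nE]] := xy.
have ijn : (i, j) \in diag_block R C r c (a i) by rewrite mem_block ab !eqxx.
have [[k l]] := exists_lt_of_sum_eq nE ijn lt.
rewrite mem_block /= => /andP[/eqP aE /eqP bE] lt'; apply: irr.
by apply: block_reducible xy lt lt' _ _; rewrite ?aE ?bE.
Qed.

Lemma irreducible_corner i i' j j' : a i != b j -> a i != b j' -> a i' != b j' ->
  y i j < x i j -> x i j' < y i j' -> y i' j' < x i' j' -> a i' = b j.
Proof.
move=> abN abN' a'bN' ij ij' i'j'; apply/eqP; apply: contraPT irr => a'bN irr'.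
apply: irr'; apply: corner_reducible xy ij ij' i'j' _.
by rewrite /swappable abN abN' a'bN a'bN' !orbT.
Qed.

End Irreducible.

Lemma irreducible_diag x y i j : paired x y -> ~ reducible B x y ->
  a i = b j -> x i j = y i j.
Proof.
move=> xy irr ab; apply/eqP; rewrite eq_le (irreducible_diag_le xy irr ab).
by apply: irreducible_diag_le ab; [apply: paired_sym | move/reducible_sym].
Qed.

(** One positive cell [(i1, j2)] already yields a hexagon; exchanging [x] and [y] then gives
    equality. *)
Lemma irreducible_le x y : paired x y -> ~ reducible B x y ->
  forall i j, x i j <= y i j.
Proof.
move=> xy irr i1 j2; rewrite leNgt; apply/negP => p12.
have yx := paired_sym xy.
have irr' : ~ reducible B y x by move/reducible_sym.
have offP i j : y i j < x i j -> a i != b j.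
  by apply: contraTneq => /(irreducible_diag xy irr) ->; rewrite ltxx.
have offN i j : x i j < y i j -> a i != b j.
  by apply: contraTneq => /(irreducible_diag xy irr) ->; rewrite ltxx.
(* p and n stand for the sign of x - y at the cell with the given indices. *)
have [j3 n13] := paired_row xy p12; have [i3 n32] := paired_col xy p12.
have [i2 p23] := paired_col yx n13; have [j1 p31] := paired_row yx n32.
(* Three L-shaped patterns through [(i1, j2)] have their fourth corners at [(i3, j3)], [(i2, j2)]
   and [(i1, j1)], which must therefore be diagonal. *)
have e3 := irreducible_corner yx irr'
  (offN _ _ n13) (offP _ _ p12) (offN _ _ n32) n13 p12 n32.
have e2 := irreducible_corner xy irr
  (offP _ _ p12) (offN _ _ n13) (offP _ _ p23) p12 n13 p23.
have e1 := irreducible_corner xy irr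
  (offP _ _ p31) (offN _ _ n32) (offP _ _ p12) p31 n32 p12.
(* An off-diagonal cell such as [(i1, j2)] separates the blocks of [i1] and [i2], as [j2] shares the
   index of [i2]. *)
have a12 : a i1 != a i2 by rewrite e2 offP.
have a13 : a i1 != a i3 by rewrite e3 offN.
have a32 : a i3 != a i2 by rewrite e2 offN.
have i12 : i1 != i2 by apply: contraNneq a12 => ->.
have i13 : i1 != i3 by apply: contraNneq a13 => ->.
have i32 : i3 != i2 by apply: contraNneq a32 => ->.
have Bz : B (cells [:: (i1, j3); (i3, j2); (i2, j1)]
             - cells [:: (i1, j2); (i3, j1); (i2, j3)]).
  apply: typeII_move; last by rewrite e1 e2 e3.
  by rewrite /= !inE negb_or a12 a13 a32.
have [x0 y0 _] := xy.
(* The sign at the sixth cell [(i2, j1)] is unknown: five cells gain and this one may lose. *)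
have [] := @exchange_le _ _ x y [:: (i1, j3); (i3, j2)]
  [:: (i1, j2); (i3, j1); (i2, j3)] [:: (i2, j1)] x0 y0.
- by rewrite /= !inE xpair_eqE (negPf i13).
- by rewrite /= !inE !xpair_eqE (negPf i12) (negPf i13) (negPf i32).
- by move=> p; rewrite !inE => /orP[]/eqP->.
- by move=> p; rewrite !inE => /or3P[]/eqP->.
move=> /= xz0 le; apply: irr; apply: (reducible_step Bz xz0).
by lia.
Qed.

(** * The proposed set is a Markov basis *)

Lemma moves_sign_invariant : sign_invariant B.
Proof.
move=> z [Az zI]; split; first by rewrite /moves statsN Az oppr0.
case: zI => [/typeIE|/typeIIE].
  move=> [i1 [i2 [j1 [j2 [iN jN ->]]]]]; left; apply/typeIE.
  by exists i1, i2, j2, j1; rewrite opprB eq_sym in jN *.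
move=> [i1 [i2 [i3 [j1 [j2 [j3 [Ua [e1 e2 e3] ->]]]]]]]; right; apply/typeIIE.
(* Exchanging the indices 2 and 3 reverses the orientation of the hexagon, hence its signs. *)
exists i1, i3, i2, j1, j3, j2; split; last 1 first.
- by rewrite opprB /cells; congr (_ - _); apply: perm_big;
    rewrite perm_cons -(perm_rot 1).
- by rewrite -(perm_uniq (s1 := [:: a i1; a i2; a i3])) // perm_cons -(perm_rot 1).
- by rewrite e1 e2 e3.
Qed.

Lemma reach_paired x y : paired x y -> reach B x y.
Proof.
case=> x0 y0 Axy; apply: (reach_of_reducible _ moves_sign_invariant _ x0 y0 Axy).
  by move=> z [].
move=> {x0 y0 Axy} {}x {}y x0 y0 Axy xNy; apply: contrapT => irr; apply: xNy.
have xy : paired x y by [].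
apply/matrixP=> i j; apply/eqP; rewrite eq_le (irreducible_le xy irr).
by apply: irreducible_le; [apply: paired_sym | move/reducible_sym].
Qed.

Lemma moves_finite : finite_set B.
Proof.
(* Six indices parametrize both types; for Type I the third row and column are fillers. *)
pose T := ('I_R * 'I_R * 'I_R * ('I_C * 'I_C * 'I_C))%type.
pose f (t : T) : 'M[int]_(R, C) := let: ((i1, i2, i3), (j1, j2, j3)) := t in
  delta_mx i1 j1 + delta_mx i2 j2 - delta_mx i1 j2 - delta_mx i2 j1.
pose g (t : T) : 'M[int]_(R, C) := let: ((i1, i2, i3), (j1, j2, j3)) := t in
  delta_mx i1 j2 + delta_mx i2 j3 + delta_mx i3 j1
  - delta_mx i1 j3 - delta_mx i2 j1 - delta_mx i3 j2.
apply: (@sub_finite_set _ _ (f @` setT `|` g @` setT)); last first.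
  by rewrite finite_setU; split; apply: finite_image; apply: finite_finset.
move=> z [_ [[i1 [i2 [j1 [j2 [_ _ ->]]]]]|]].
  by left; exists ((i1, i2, i1), (j1, j2, j1)).
move=> [i1 [i2 [i3 [j1 [j2 [j3 [_ _ _ _ ->]]]]]]].
by right; exists ((i1, i2, i3), (j1, j2, j3)).
Qed.

Lemma moves_markov_basis : markov_basis A B.
Proof.
split; [exact: moves_finite | by move=> z [] | exact: moves_sign_invariant |].
move=> t x y xt yt xNy; apply: (reach_connected _ xNy xt); first by move=> z [].
by apply: reach_paired; case: xt yt => x0 <- [y0 yx]; split.
Qed.

(** * Two-element fibers and uniqueness *)

Lemma typeI_fiber i1 i2 j1 j2 x : i1 != i2 -> j1 != j2 -> nonneg x ->
  stats A x = stats A (cells [:: (i1, j2); (i2, j1)]) ->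
  x = cells [:: (i1, j2); (i2, j1)] \/ x = cells [:: (i1, j1); (i2, j2)].
Proof.
move=> iN jN x0 xs.
have row0 i j : i \notin [:: i1; i2] -> x i j = 0 by apply: (fiber_row0 x0 xs).
have col0 i j : j \notin [:: j1; j2] -> x i j = 0.
  by move=> jj; apply: (fiber_col0 x0 xs); rewrite /= !inE orbC in jj *.
have rowE i : x i j1 + x i j2 = ((i1 == i) + (i2 == i))%:R.
  have := fiber_row xs i; rewrite (sum_support (s := [:: (i, j1); (i, j2)])).
  - by rewrite !big_cons big_nil /= !addn0 addr0.
  - by rewrite /= !inE xpair_eqE (negPf jN) andbF.
  - by rewrite /= eqxx.
  - move=> [k l] /= /eqP->; rewrite !inE !xpair_eqE eqxx /= => jj.
    by apply: col0; rewrite !inE.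
have colE j : x i1 j + x i2 j = ((j2 == j) + (j1 == j))%:R.
  have := fiber_col xs j; rewrite (sum_support (s := [:: (i1, j); (i2, j)])).
  - by rewrite !big_cons big_nil /= !addn0 addr0.
  - by rewrite /= !inE xpair_eqE (negPf iN).
  - by rewrite /= eqxx.
  - move=> [k l] /= /eqP->; rewrite !inE !xpair_eqE eqxx !andbT /= => ii.
    by apply: row0; rewrite !inE.
have := rowE i1; have := rowE i2; have := colE j1; have := colE j2.
rewrite !eqxx [i2 == i1]eq_sym [j2 == j1]eq_sym (negPf iN) (negPf jN) => c2 c1 r2 r1.
have p11 := x0 i1 j1; have p12 := x0 i1 j2.
(* The unit row and column sums of the 2 x 2 subtable leave [x i1 j1] as the only parameter. *)
apply: (@eq_cells_cat _ _ _ _ _ (x i1 j1)); last 1 first.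
- move=> [i j] ijN; have [iS|/row0 //] := boolP (i \in [:: i1; i2]).
  have [jS|/col0 //] := boolP (j \in [:: j1; j2]).
  move: iS jS ijN; rewrite !inE !xpair_eqE.
  by move=> /orP[]/eqP-> /orP[]/eqP->; rewrite !eqxx ?orbT.
- by rewrite /= !inE !xpair_eqE !eqxx [i2 == i1]eq_sym [j2 == j1]eq_sym
    (negPf iN) (negPf jN).
- by lia.
- by move=> p; rewrite !inE => /orP[]/eqP->//=; lia.
- by move=> p; rewrite !inE => /orP[]/eqP->/=; lia.
Qed.

(** Once the three cells [(i_a, j_a)] vanish, each row and column of the subtable keeps two cells of
    sum 1, so the entries alternate around the hexagon. *)
Lemma typeII_fiber i1 i2 i3 j1 j2 j3 x :
  uniq [:: a i1; a i2; a i3] -> [:: a i1; a i2; a i3] = [:: b j1; b j2; b j3] ->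
  nonneg x -> stats A x = stats A (cells [:: (i1, j3); (i2, j1); (i3, j2)]) ->
  x = cells [:: (i1, j3); (i2, j1); (i3, j2)] \/
  x = cells [:: (i1, j2); (i2, j3); (i3, j1)].
Proof.
move=> Ua abE x0 xs.
have Ui : uniq [:: i1; i2; i3] by apply: (@map_uniq _ _ a).
have Uj : uniq [:: j1; j2; j3] by apply: (@map_uniq _ _ b); rewrite [map _ _]/= -abE.
case: abE => e1 e2 e3.
move: Ua; rewrite /= !inE negb_or => /and3P[/andP[a12 a13] a23 _].
move: Ui; rewrite /= !inE negb_or => /and3P[/andP[i12 i13] i23 _].
move: Uj; rewrite /= !inE negb_or => /and3P[/andP[j12 j13] j23 _].
have row0 i j : i \notin [:: i1; i2; i3] -> x i j = 0 by apply: (fiber_row0 x0 xs).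
have col0 i j : j \notin [:: j1; j2; j3] -> x i j = 0.
  move=> jj; apply: (fiber_col0 x0 xs); apply: contra jj; rewrite /= !inE.
  by case/or3P=> /eqP->; rewrite eqxx ?orbT.
(* No cell of the hexagon is diagonal, so every diagonal block has sum zero. This is where the
   condition on the zero cells in [typeII] matters. *)
have diag0 i j : a i = b j -> x i j = 0.
  move=> ab; apply: (fiber_block0 (n := a i) x0 xs); last by rewrite mem_block ab !eqxx.
  by rewrite /= !mem_diag_block_off // -?e1 -?e2 -?e3 // eq_sym.
have rowE i : x i j1 + x i j2 + x i j3 = ((i1 == i) + (i2 == i) + (i3 == i))%:R.
  have := fiber_row xs i.
  rewrite (sum_support (s := [:: (i, j1); (i, j2); (i, j3)])).
  - by rewrite !big_cons big_nil /= !addn0 addr0 addrA addnA.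
  - by rewrite /= !inE !xpair_eqE (negPf j12) (negPf j13) (negPf j23) !andbF.
  - by rewrite /= eqxx.
  - move=> [k l] /= /eqP->; rewrite !inE !xpair_eqE eqxx /= => jj.
    by apply: col0; rewrite !inE.
have colE j : x i1 j + x i2 j + x i3 j = ((j3 == j) + (j1 == j) + (j2 == j))%:R.
  have := fiber_col xs j.
  rewrite (sum_support (s := [:: (i1, j); (i2, j); (i3, j)])).
  - by rewrite !big_cons big_nil /= !addn0 addr0 addrA addnA.
  - by rewrite /= !inE !xpair_eqE (negPf i12) (negPf i13) (negPf i23).
  - by rewrite /= eqxx.
  - move=> [k l] /= /eqP->; rewrite !inE !xpair_eqE eqxx !andbT /= => ii.
    by apply: row0; rewrite !inE.
have := colE j1; have := colE j2; have := colE j3.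
have := rowE i1; have := rowE i2; have := rowE i3.
rewrite !eqxx (diag0 _ _ e1) (diag0 _ _ e2) (diag0 _ _ e3).
rewrite [i2 == i1]eq_sym [i3 == i1]eq_sym [i3 == i2]eq_sym
  (negPf i12) (negPf i13) (negPf i23).
rewrite [j2 == j1]eq_sym [j3 == j1]eq_sym [j3 == j2]eq_sym
  (negPf j12) (negPf j13) (negPf j23).
move=> r3 r2 r1 c3 c2 c1; have p12 := x0 i1 j2; have p13 := x0 i1 j3.
apply: (@eq_cells_cat _ _ _ _ _ (x i1 j2)); last 1 first.
- move=> [i j] ijN; have [iS|/row0 //] := boolP (i \in [:: i1; i2; i3]).
  have [jS|/col0 //] := boolP (j \in [:: j1; j2; j3]).
  move: iS jS ijN; rewrite !inE !xpair_eqE.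
  by move=> /or3P[]/eqP-> /or3P[]/eqP->;
    rewrite ?(diag0 _ _ e1) ?(diag0 _ _ e2) ?(diag0 _ _ e3) ?eqxx ?orbT.
- rewrite /= !inE !xpair_eqE (eq_sym i2 i1) (eq_sym i3 i1) (eq_sym i3 i2).
  rewrite (negPf i12) (negPf i13) (negPf i23) !eqxx.
  rewrite [j3 == j2]eq_sym [j2 == j1]eq_sym [j3 == j1]eq_sym.
  by rewrite (negPf j12) (negPf j13) (negPf j23) !andbF.
- by lia.
- by move=> p; rewrite !inE => /or3P[]/eqP->//=; lia.
- by move=> p; rewrite !inE => /or3P[]/eqP->/=; lia.
Qed.

Lemma moves_least B' : markov_basis A B' -> B `<=` B'.
Proof.
move=> mB' z [Az [/typeIE|/typeIIE]].
  move=> [i1 [i2 [j1 [j2 [iN jN zE]]]]]; rewrite zE in Az *.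
  apply: (indispensable_move mB'); try exact: nonneg_cells.
  - exact/esym/movesB.
  - move/matrixP => /(_ i1 j1); rewrite !cellsE /= !xpair_eqE !eqxx.
    by rewrite [j2 == _]eq_sym [i2 == _]eq_sym (negPf iN) (negPf jN).
  - by move=> x x0 xs; apply: typeI_fiber.
move=> [i1 [i2 [i3 [j1 [j2 [j3 [Ua abE zE]]]]]]]; rewrite zE in Az *.
apply: (indispensable_move mB'); try exact: nonneg_cells.
- exact/esym/movesB.
- have Ui : uniq [:: i1; i2; i3] by apply: (@map_uniq _ _ a).
  have Uj : uniq [:: j1; j2; j3] by apply: (@map_uniq _ _ b); rewrite [map _ _]/= -abE.
  move: Ui Uj; rewrite /= !inE !negb_or => /and3P[/andP[i12 i13] _ _].
  move=> /and3P[_ j23 _].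
  move/matrixP => /(_ i1 j2); rewrite !cellsE /= !xpair_eqE !eqxx.
  by rewrite [i2 == _]eq_sym [i3 == _]eq_sym [j3 == _]eq_sym
    (negPf i12) (negPf i13) (negPf j23).
- by move=> x x0 xs; apply: typeII_fiber.
Qed.

Lemma moves_unique_minimal : unique_minimal_markov_basis A B.
Proof.
exact: unique_minimal_of_indispensable moves_markov_basis moves_least.
Qed.

End BlockModel.

(** * Cutting an interval into blocks, and the conclusion *)

Lemma interval_partition (f : nat -> nat) (n m : nat) :
  f 0%N = 0%N -> f n = m -> (forall k, (k < n)%N -> (f k < f k.+1)%N) ->
  exists g : 'I_m -> 'I_n,
    forall (i : 'I_m) (k : 'I_n), (f k <= i < f k.+1)%N = (g i == k).
Proof.
move=> f0 fn fS.
have f_mono k l : (k <= l <= n)%N -> (f k <= f l)%N.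
  elim: l => [|l IHl] /andP[kl ln]; first by move: kl; rewrite leqn0 => /eqP->.
  move: kl; rewrite leq_eqVlt => /predU1P[->//|kl].
  by apply: leq_trans (IHl _) (ltnW (fS l ln)); rewrite -ltnS kl ltnW.
have ex (i : 'I_m) : exists k : 'I_n, (f k <= i < f k.+1)%N.
  have exk : exists k, (i < f k)%N by exists n; rewrite fn.
  (* The block index is the predecessor of the least [k] with [i < f k]; this least value is not 0
     because [f 0 = 0]. *)
  case: (ex_minnP exk) => -[|k] ik min_k; first by rewrite f0 in ik.
  have kn : (k < n)%N by apply: min_k; rewrite fn.
  exists (Ordinal kn); rewrite /= ik andbT leqNgt; apply/negP => /min_k.
  by rewrite ltnn.
have [g gP] := choice ex.
exists g => i k; apply/idP/eqP => [|<-//].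
move: (gP i) => /andP[g1 g2] /andP[k1 k2]; apply/val_inj/eqP; rewrite /= eqn_leq.
apply/andP; split; rewrite leqNgt; apply/negP => lt.
- have := f_mono k.+1 (g i); rewrite lt ltnW //= => /(_ isT); lia.
- have := f_mono (g i).+1 k; rewrite lt ltnW //= => /(_ isT); lia.
Qed.

Theorem proposition1 (R C N : nat) (r c : nat -> nat)
  (R_gt0 : (1 <= R)%N) (C_gt0 : (1 <= C)%N) (N_ge2 : (2 <= N)%N)
  (r_first : r 0%N = 0%N) (r_last : r N = R)
  (r_incr : forall k : nat, (k < N)%N -> (r k < r k.+1)%N)
  (c_first : c 0%N = 0%N) (c_last : c N = C)
  (c_incr : forall k : nat, (k < N)%N -> (c k < c k.+1)%N) :
  let A := config (@diag_block R C N r c) in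
  (N = 2%N ->
     unique_minimal_markov_basis A (moves A `&` @typeI R C)) /\
  ((3 <= N)%N ->
     unique_minimal_markov_basis A
       (moves A `&` (@typeI R C `|` @typeII R C N r c))).
Proof.
have [a aP] := interval_partition r_first r_last r_incr.
have [b bP] := interval_partition c_first c_last c_incr.
have mem_block k l (i : 'I_R) (j : 'I_C) :
    ((i, j) \in block R C r c k l) = (a i == k) && (b j == l).
  by rewrite inE /= aP bP.
have min := moves_unique_minimal mem_block.
(* For [N = 2] there is no move of Type II, since it needs three distinct block indices. *)
split=> [N2|_] //; rewrite (_ : @typeI R C = @typeI R C `|` typeII N r c) //.
apply/seteqP; split=> z; first by left.
case=> // /(typeIIE mem_block)[i1 [i2 [i3 [j1 [j2 [j3 [Ua _ _]]]]]]].
have := max_card (mem [:: a i1; a i2; a i3]); rewrite (card_uniqP Ua) card_ord => N3.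
by move/eqP: N2; rewrite eqn_leq leqNgt N3.
Qed.
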